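(* Let $X$ be a Hadamard space and let $f: X\to\mathbb{R}$ be a continuous convex function. Then $\operatorname{dom} f^* \subseteq B(f^{\infty})$.
   Context: A Hadamard space is a complete CAT(0) space; a function on it is convex if it is convex along every geodesic. A geodesic ray is a map $c:[0,\infty)\to X$ with $d(c(s),c(t))=|s-t|$; a constant-speed ray is a map $t\mapsto c(rt)$ with $c$ a geodesic ray and $r\ge 0$. Geodesic rays are asymptotic if they stay at bounded distance; $X^{\infty}$ is the set of asymptotic classes, $c(\infty)$ the class of $c$. The angle is $\angle(\xi,\xi') := \lim_{t,t'\to\infty}\overline{\angle}_x(c(t),c'(t'))$, with $c,c'$ the geodesic rays from $x$ in the classes $\xi,\xi'$ and $\overline{\angle}_x$ the Euclidean comparison angle (independent of $x$). The Euclidean cone $CX^{\infty}$ is $\mathbb{R}_+\times X^{\infty}$ modulo identifying all $(0,\xi)$ to a point $0$; the class of $(r,\xi)$ is written $r\xi$, and $X^\infty\subseteq CX^\infty$ via $\xi=1\xi$. A constant-speed ray $c^*(t)=c(rt)$ has $c^*(\infty):=r\,c(\infty)$. For $p=r\xi$, $q=r'\xi'$: $\|p\|:=r$ and $\langle p,q\rangle:=rr'\cos\angle(\xi,\xi')$. Fix a base point $x_0\in X$. For a geodesic ray $c$ the Busemann function is $b_c(x):=\lim_{t\to\infty} d(x,c(t))-t$; for $p=r\xi\in CX^\infty$, $b_p:=r\,b_c$ where $c$ is the geodesic ray with $c(0)=x_0$, $c(\infty)=\xi$. The asymptotic Legendre-Fenchel conjugate is $f^*(p):=\sup_{x\in X}\,(-b_p(x)-f(x))$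 for $p \in CX^\infty$, and $\operatorname{dom} f^*:=\{p\in CX^\infty\mid f^*(p)<\infty\}$. The recession function is $f^{\infty}(p):=\lim_{t\to\infty} f(c(t))/t$ for any constant-speed ray $c$ with $c(\infty)=p$ (independent of $c$). For positively homogeneous $h:CX^\infty\to\mathbb{R}\cup\{\infty\}$, $B(h):=\{p\in CX^\infty\mid \langle u,p\rangle\le h(u)\ \forall u\in X^\infty\}$. *)

(* Defs.v *)
From HB Require Import structures.
From mathcomp Require Import all_boot all_order all_algebra.
From mathcomp Require Import generic_quotient.
From mathcomp Require Import all_classical all_reals all_analysis.

Set Implicit Arguments.
Unset Strict Implicit.
Unset Printing Implicit Defensive.

Import Order.TTheory GRing.Theory Num.Theory.
Import numFieldNormedType.Exports.

Local Open Scope classical_set_scope.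
Local Open Scope ring_scope.
Local Open Scope quotient_scope.

Section cat0.
Context {R : realType} {X : metricType R}.

Definition geodesic (x y : X) (c : R -> X) :=
  [/\ c 0 = x, c (mdist x y) = y &
   {in `[0, mdist x y] &, forall s t, mdist (c s) (c t) = `|s - t|}].

(* [R * R] and ['rV[R]_2] carry the sup norm in the library. *)
Definition plane_dist (a b : R * R) : R :=
  Num.sqrt ((a.1 - b.1) ^+ 2 + (a.2 - b.2) ^+ 2).

(* Two points on a triangle lie on two sides that issue from a common vertex
   [p] (or on one side, where the comparison is an equality); [a] and [b] are
   their relative positions on [p q] and [p r], and (p', q', r') is any
   comparison triangle. *)
Definition triangle_comparison (p q r : X) (c c' : R -> X) :=
  forall p' q' r' : R * R,
    plane_dist p' q' = mdist p q -> plane_dist p' r' = mdist p r ->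
    plane_dist q' r' = mdist q r ->
  {in `[0, 1] &, forall a b : R,
    mdist (c (a * mdist p q)) (c' (b * mdist p r)) <=
    plane_dist ((1 - a) * p'.1 + a * q'.1, (1 - a) * p'.2 + a * q'.2)
               ((1 - b) * p'.1 + b * r'.1, (1 - b) * p'.2 + b * r'.2)}.

Definition cat0 :=
  (forall x y, exists c, geodesic x y c) /\
  (forall p q r c c', geodesic p q c -> geodesic p r c' ->
     triangle_comparison p q r c c').

End cat0.

HB.mixin Record Metric_isCAT0 (R : realType) X & Metric R X := {
  cat0P : @cat0 R X
}.

#[short(type="hadamardType")]
HB.structure Definition Hadamard (R : realType) :=
  {X of Complete X & Metric R X & Metric_isCAT0 R X}.

Section boundary.
Context {R : realType} (X : metricType R).

(* Rays are functions on the whole of [R], of which only the values on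
   [0, +oo[ matter. *)
Definition geodesic_ray : set (R -> X) :=
  [set c | forall s t, 0 <= s -> 0 <= t -> mdist (c s) (c t) = `|s - t|].

Definition asymptotic (c c' : R -> X) :=
  exists K : R, forall t, 0 <= t -> mdist (c t) (c' t) <= K.

Definition asymptotic_rel (c c' : geodesic_ray) : bool :=
  `[< asymptotic (val c) (val c') >].

Lemma asymptotic_refl : reflexive asymptotic_rel.
Proof. by move=> c; apply/asboolP; exists 0 => t _; rewrite mdistxx. Qed.

Lemma asymptotic_sym : symmetric asymptotic_rel.
Proof.
move=> c c'; apply/asboolP/asboolP => -[K cK]; exists K => t t0;
  by rewrite metric_sym cK.
Qed.

Lemma asymptotic_trans : transitive asymptotic_rel.
Proof.
move=> c' c c'' /asboolP[K cK] /asboolP[L cL]; apply/asboolP; exists (K + L).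
move=> t t0; apply: le_trans (metric_triangle _ (val c' t) _) _.
by rewrite lerD ?cK ?cL.
Qed.

Canonical asymptotic_equiv :=
  EquivRel asymptotic_rel asymptotic_refl asymptotic_sym asymptotic_trans.

Definition boundary := {eq_quot asymptotic_equiv}.

Definition endpoint (c : geodesic_ray) : boundary := \pi_boundary c.

Definition cone_rel (p q : {nonneg R} * boundary) : bool :=
  (p.1 == q.1) && ((p.1%:num == 0) || (p.2 == q.2)).

Lemma cone_refl : reflexive cone_rel.
Proof. by move=> p; rewrite /cone_rel !eqxx orbT. Qed.

Lemma cone_sym : symmetric cone_rel.
Proof.
by move=> p q; rewrite /cone_rel eq_sym; case: eqP => //= ->; rewrite (eq_sym p.2).
Qed.

Lemma cone_trans : transitive cone_rel.
Proof.
move=> q p r /andP[/eqP pq1 pq2] /andP[/eqP qr1 qr2].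
rewrite /cone_rel pq1 qr1 eqxx /=; move: pq2 qr2; rewrite pq1 qr1.
by case: eqP => //= _ /eqP -> /eqP ->.
Qed.

Canonical cone_equiv := EquivRel cone_rel cone_refl cone_sym cone_trans.

Definition cone := {eq_quot cone_equiv}.

Definition cone_pt (r : {nonneg R}) (xi : boundary) : cone := \pi_cone (r, xi).

Definition cone_of_boundary (xi : boundary) : cone := cone_pt 1%:nng xi.

End boundary.

Arguments geodesic_ray {R} X.

Section asymptotic_conjugate.
Context {R : realType} {X : metricType R}.
Implicit Types (xi : boundary X) (p q : cone X) (f : X -> R).

Definition ray_from (x : X) xi : set (geodesic_ray X) :=
  [set c | val c 0 = x /\ endpoint c = xi].

(* Law of cosines; meaningful only for y and z different from x. *)
Definition comparison_angle (x y z : X) : R :=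
  acos ((mdist x y ^+ 2 + mdist x z ^+ 2 - mdist y z ^+ 2) /
        (2 * mdist x y * mdist x z)).

(* The limit exists and is the same for all base points [x] when [X] is
   Hadamard. *)
Definition angle xi xi' : R :=
  get [set theta : R | exists x c c', [/\ ray_from x xi c, ray_from x xi' c' &
    (fun t : R * R => comparison_angle x (val c t.1) (val c' t.2)) @
      (pinfty_nbhs R, pinfty_nbhs R) --> theta]].

(* [cone_norm] and [cone_dir] take a representative (r, xi) of p = r xi; the
   choice of xi when r = 0 is immaterial in [cone_inner] and
   [cone_busemann]. *)
Definition cone_norm p : R := (repr p).1%:num.
Definition cone_dir p : boundary X := (repr p).2.

Definition cone_inner p q : R :=
  cone_norm p * cone_norm q * cos (angle (cone_dir p) (cone_dir q)).

Definition busemann (c : R -> X) (x : X) : R :=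
  lim ((mdist x (c t) - t) @[t --> +oo]).

(* Unique on [0, +oo[ when X is Hadamard. *)
Definition based_ray (x0 : X) xi : R -> X :=
  xget (fun=> x0) [set val c | c in ray_from x0 xi].

Definition cone_busemann (x0 : X) p (x : X) : R :=
  cone_norm p * busemann (based_ray x0 (cone_dir p)) x.

Definition conjugate (x0 : X) f p : \bar R :=
  ereal_sup [set (- cone_busemann x0 p x - f x)%:E | x in setT].

Definition dom_conjugate (x0 : X) f : set (cone X) :=
  [set p | (conjugate x0 f p < +oo)%E].

Definition constant_speed_ray_to p : set (R -> X) :=
  [set c' | exists r (c : geodesic_ray X),
    (c' = fun t => val c (r%:num * t)) /\ cone_pt r (endpoint c) = p].

(* For f convex and continuous on a Hadamard space, the limit exists and is the
   same for all such rays. *)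
Definition recession f p : \bar R :=
  get [set l : \bar R | exists2 c, constant_speed_ray_to p c &
    (f (c t) / t)%:E @[t --> +oo] --> l].

Definition B (h : cone X -> \bar R) : set (cone X) :=
  [set p | forall xi, ((cone_inner (cone_of_boundary xi) p)%:E
                       <= h (cone_of_boundary xi))%E].

Definition geodesically_convex f :=
  forall x y c, geodesic x y c ->
    convex_function `[0, mdist x y]%classic (f \o c : R^o -> R^o).

End asymptotic_conjugate.

(* Main.v *)
(** The CAT(0) inequality, written as a law of cosines, shows that comparison
    angles between two rays from a common point increase with the parameters;
    so their limit, the angle theta, satisfies
    [d(c t, c' s)^2 <= t^2 + s^2 - 2 t s cos theta].  Letting [s] tend to
    infinity gives [b_c'(c t) <= - t cos theta], so a point [p] of the domain of
    the conjugate satisfies [f(c t) >= t <u, p> - constant] along any ray [c]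
    in the class [u]; dividing by [t] gives the claim.  The limits defining the
    angle and the Busemann function exist only once there are rays from every
    base point in every class: such a ray is the limit of the geodesics from
    the base point to [c T], which converge because their comparison angles at
    the base point tend to 0, and its existence uses completeness.  The limit
    defining the recession function exists because slopes of convex functions
    increase. *)

Require Import Defs.
From mathcomp Require Import all_boot all_order all_algebra.
From mathcomp Require Import all_classical all_reals all_analysis.
From mathcomp Require Import lra ring.
Import numFieldNormedType.Exports.
Local Open Scope classical_set_scope.

Set Implicit Arguments.
Unset Strict Implicit.
Unset Printing Implicit Defensive.

Import Order.TTheory GRing.Theory Num.Theory.

Local Open Scope ring_scope.

(** * Comparison triangles in the Euclidean plane *)

Section comparison_triangle.
Context {R : realType}.

Lemma plane_dist_sqr (a b : R * R) :
  plane_dist a b ^+ 2 = (a.1 - b.1) ^+ 2 + (a.2 - b.2) ^+ 2.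
Proof. by rewrite sqr_sqrtr// addr_ge0 ?sqr_ge0. Qed.

Lemma plane_dist_eq (a b : R * R) (d : R) : 0 <= d ->
  (a.1 - b.1) ^+ 2 + (a.2 - b.2) ^+ 2 = d ^+ 2 -> plane_dist a b = d.
Proof. by move=> d0; rewrite /plane_dist => ->; rewrite sqrtr_sqr ger0_norm. Qed.

(** The side of length [x] is put on the first axis; the law of cosines then gives the abscissa [u]
    of the third vertex, and the triangle inequalities give [|u| <= y], so that its ordinate is
    real. The formula for [u] divides by [x], hence the separate case [x = 0]. *)
Lemma plane_triangle_exists (x y z : R) :
    0 <= x -> 0 <= y -> 0 <= z -> x <= y + z -> y <= x + z -> z <= x + y ->
  exists q r : R * R, [/\ plane_dist (0, 0) q = x, plane_dist (0, 0) r = y &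
    plane_dist q r = z].
Proof.
move=> x0 y0 z0 xyz yxz zxy.
have [x_eq0|x_neq0] := eqVneq x 0.
  exists (0, 0), (y, 0); split; apply: plane_dist_eq => //=; rewrite ?x_eq0;
    first by ring.
    by ring.
  have -> : z = y by lra.
  by ring.
have x_gt0 : 0 < x by rewrite lt_neqAle eq_sym x_neq0.
pose u := (x ^+ 2 + y ^+ 2 - z ^+ 2) / (2 * x).
have uE : 2 * x * u = x ^+ 2 + y ^+ 2 - z ^+ 2 by rewrite /u; field.
have uy : `|u| <= y.
  rewrite ler_norml; apply/andP; split.
    by rewrite ler_pdivlMr ?mulr_gt0//; nra.
  by rewrite ler_pdivrMr ?mulr_gt0//; nra.
have v0 : 0 <= y ^+ 2 - u ^+ 2.
  by rewrite subr_ge0 -(real_normK (num_real u)) lerXn2r ?nnegrE.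
exists (x, 0), (u, Num.sqrt (y ^+ 2 - u ^+ 2)).
split; apply: plane_dist_eq => //=.
- by ring.
- by rewrite !sub0r !sqrrN sqr_sqrtr//; ring.
- rewrite sub0r sqrrN sqr_sqrtr//.
  have -> : (x - u) ^+ 2 + (y ^+ 2 - u ^+ 2) = x ^+ 2 + y ^+ 2 - 2 * x * u by ring.
  by rewrite uE; ring.
Qed.

End comparison_triangle.

(** With [p'] at the origin, the right-hand side is [|a q' - b r'|^2] expanded, twice the inner
    product of [q'] and [r'] being rewritten by polarization. No trace of the comparison triangle
    remains. *)
Lemma cat0_sides_dist (R : realType) (X : hadamardType R) (p q r : X)
    (c c' : R -> X) (a b : R) :
    geodesic p q c -> geodesic p r c' -> 0 <= a <= 1 -> 0 <= b <= 1 ->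
  mdist (c (a * mdist p q)) (c' (b * mdist p r)) ^+ 2 <=
  a ^+ 2 * mdist p q ^+ 2 + b ^+ 2 * mdist p r ^+ 2 -
  a * b * (mdist p q ^+ 2 + mdist p r ^+ 2 - mdist q r ^+ 2).
Proof.
move=> cpq cpr a01 b01.
have [||||||q' [r' [pq pr qr]]] :=
  @plane_triangle_exists R (mdist p q) (mdist p r) (mdist q r);
  rewrite ?mdist_ge0//.
- by rewrite (metric_sym q r) metric_triangle.
- exact: metric_triangle.
- by rewrite (metric_sym p q) metric_triangle.
have := (cat0P (R := R) (s := X)).2 _ _ _ _ _ cpq cpr _ _ _ pq pr qr a b.
rewrite !in_itv/= => /(_ a01 b01) le_plane.
apply: (@le_trans _ _ (plane_dist
    ((1 - a) * 0 + a * q'.1, (1 - a) * 0 + a * q'.2)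
    ((1 - b) * 0 + b * r'.1, (1 - b) * 0 + b * r'.2) ^+ 2)).
  by rewrite lerXn2r ?nnegrE ?mdist_ge0// (le_trans _ le_plane)// mdist_ge0.
by rewrite -pq -pr -qr !plane_dist_sqr/=; lra.
Qed.

(** * Distance estimates for geodesics and rays *)

Section geodesics.
Context {R : realType} {X : metricType R}.

Lemma mdist_sub_le (x y z : X) : `|mdist x y - mdist x z| <= mdist y z.
Proof.
rewrite ler_norml; apply/andP; split.
  by have := metric_triangle x y z; lra.
by have := metric_triangle x z y; rewrite (metric_sym z y); lra.
Qed.

Lemma geodesic_rev (x y : X) (c : R -> X) :
  geodesic x y c -> geodesic y x (fun t => c (mdist x y - t)).
Proof.
move=> [c0 cd cE]; split.
- by rewrite subr0.
- by rewrite (metric_sym y x) subrr.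
- move=> s t; rewrite (metric_sym y x) !in_itv/= => /andP[s0 sd] /andP[t0 td].
  rewrite cE ?in_itv/=; last 2 first.
  + by apply/andP; split; lra.
  + by apply/andP; split; lra.
  by rewrite -normrN; congr (`| _ |); ring.
Qed.

Lemma ray_dist0 (c : R -> X) (t : R) : geodesic_ray X c -> 0 <= t ->
  mdist (c 0) (c t) = t.
Proof. by move=> cr t0; rewrite cr// sub0r normrN ger0_norm. Qed.

Lemma ray_geodesic (c : R -> X) (t : R) : geodesic_ray X c -> 0 <= t ->
  geodesic (c 0) (c t) c.
Proof.
move=> cr t0; rewrite /geodesic ray_dist0//; split => // s u.
by rewrite !in_itv/= => /andP[s0 _] /andP[u0 _]; exact: cr.
Qed.

Lemma ray_dist_sub (c : R -> X) (x : X) (t : R) : geodesic_ray X c -> 0 <= t ->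
  `|mdist x (c t) - t| <= mdist x (c 0).
Proof.
move=> cr t0; have := mdist_sub_le (c t) x (c 0).
by rewrite (metric_sym _ x) (metric_sym _ (c 0)) ray_dist0.
Qed.

Lemma mdist_nested (x y x' y' : X) :
  mdist x y <= mdist x x' + mdist x' y' + mdist y y'.
Proof.
rewrite -addrA (le_trans (metric_triangle _ x' _))// lerD2l.
by rewrite (metric_sym y) metric_triangle.
Qed.

End geodesics.

(** * Rays from a given point in a given asymptotic class *)

Section asymptotic_ray.
Context {R : realType} {X : hadamardType R}.
Implicit Types (c s : R -> X) (x : X).

(* The squared chord is [t ^ 2 (2 - 2 cos alpha)], with [alpha] the comparison
   angle at [x] of the triangle [x, c T, c S]; since [d(x, c S) - d(x, c T)]
   differs from [S - T] by at most [2 d(x, c 0)], [alpha] is small for large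
   [T]. *)
Lemma geodesics_to_ray_dist c x s s' (T S t : R) :
    geodesic_ray X c -> geodesic x (c T) s -> geodesic x (c S) s' ->
    0 < T -> 2 * mdist x (c 0) <= T -> T <= S -> 0 <= t -> 2 * t <= T ->
  mdist (s t) (s' t) ^+ 2 <= 16 * mdist x (c 0) * t ^+ 2 / T.
Proof.
move=> cr sT s'S T0 dT TS t0 tT; set d := mdist x (c 0) in dT *.
have d0 : 0 <= d by exact: mdist_ge0.
have := ray_dist_sub x cr (ltW T0); have := @ray_dist_sub _ _ c x S cr.
rewrite -/d; set D := mdist x (c T); set E := mdist x (c S).
move=> /(_ (ltW (lt_le_trans T0 TS))).
rewrite !ler_norml => /andP[E1 E2] /andP[D1 D2].
have D_ge : T <= 2 * D by lra.
have E_ge : S <= 2 * E by lra.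
have D0 : 0 < D by lra.
have E0 : 0 < E by lra.
have cTS : mdist (c T) (c S) = S - T.
  by rewrite cr; [rewrite distrC ger0_norm// subr_ge0|lra|lra].
have ST_ge : E - D <= S - T.
  by rewrite -cTS; have := mdist_sub_le x (c S) (c T); rewrite ler_norml
    (metric_sym (c S)) => /andP[].
have ST_le : D - E <= S - T.
  by rewrite -cTS; have := mdist_sub_le x (c T) (c S); rewrite ler_norml
    => /andP[].
have a01 : 0 <= t / D <= 1.
  by rewrite divr_ge0 ?(ltW D0)//= ler_pdivrMr// mul1r; lra.
have b01 : 0 <= t / E <= 1.
  by rewrite divr_ge0 ?(ltW E0)//= ler_pdivrMr// mul1r; lra.
have := cat0_sides_dist sT s'S a01 b01.
rewrite -/D -/E cTS !divfK ?gt_eqF// => /le_trans; apply.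
have -> : (t / D) ^+ 2 * D ^+ 2 + (t / E) ^+ 2 * E ^+ 2 -
    t / D * (t / E) * (D ^+ 2 + E ^+ 2 - (S - T) ^+ 2) =
    t ^+ 2 * (((S - T) ^+ 2 - (E - D) ^+ 2) / (D * E)).
  by field; rewrite !gt_eqF.
have -> : 16 * d * t ^+ 2 / T = t ^+ 2 * (16 * d / T).
  by field; rewrite gt_eqF.
rewrite ler_wpM2l ?sqr_ge0// ler_pdivrMr ?mulr_gt0//.
rewrite mulrAC ler_pdivlMr//.
(* The difference of squares factors: [S - T - (E - D) <= 2 * d] and [S - T + (E - D) <= 2 * S].
   Afterwards [S <= 2 * E] and [T <= 2 * D] replace [S * T] by [4 * D * E]. *)
apply: (@le_trans _ _ (4 * d * S * T)).
  rewrite ler_wpM2r ?(ltW T0)//.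
  have -> : (S - T) ^+ 2 - (E - D) ^+ 2 =
    (S - T - (E - D)) * (S - T + (E - D)) by ring.
  have -> : 4 * d * S = (2 * d) * (2 * S) by ring.
  by apply: ler_pM; lra.
have -> : 16 * d * (D * E) = 4 * d * ((2 * E) * (2 * D)) by ring.
rewrite -mulrA ler_wpM2l ?mulr_ge0//.
by apply: ler_pM => //; lra.
Qed.

(* Comparison at the vertex [c T], from which both sides are scaled by the same
   factor. *)
Lemma geodesic_to_ray_dist c x s (T t : R) :
    geodesic_ray X c -> geodesic x (c T) s -> 0 < T ->
    0 <= t -> 2 * t <= T -> 2 * mdist x (c 0) <= T ->
  mdist (s t) (c t) <= 2 * mdist x (c 0).
Proof.
move=> cr sT T0 t0 tT dT; set d := mdist x (c 0) in dT *.
have d0 : 0 <= d by exact: mdist_ge0.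
have := ray_dist_sub x cr (ltW T0); rewrite -/d.
set D := mdist x (c T); rewrite ler_norml => /andP[D1 D2].
have cT := ray_dist0 cr (ltW T0).
have cT' : mdist (c T) (c 0) = T by rewrite metric_sym.
have a01 : 0 <= 1 - t / T <= 1.
  by rewrite subr_ge0 gerBl divr_ge0 ?(ltW T0)// ler_pdivrMr// mul1r; lra.
have := cat0_sides_dist (geodesic_rev sT)
  (geodesic_rev (ray_geodesic cr (ltW T0))) a01 a01.
rewrite cT cT' (metric_sym (c T) x) -/D -/d.
have -> : D - (1 - t / T) * D = t / T * D by ring.
have -> : T - (1 - t / T) * T = t by field; rewrite gt_eqF.
set u := 1 - t / T in a01 *.
have -> : u ^+ 2 * D ^+ 2 + u ^+ 2 * T ^+ 2 -
  u * u * (D ^+ 2 + T ^+ 2 - d ^+ 2) = (u * d) ^+ 2 by ring.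
case/andP: a01 => u0 u1.
rewrite ler_sqr ?nnegrE ?mdist_ge0 ?mulr_ge0// => le_ud.
have le_d : mdist (s (t / T * D)) (c t) <= d.
  by rewrite (le_trans le_ud)// ler_piMl.
rewrite (le_trans (metric_triangle _ (s (t / T * D)) _))//.
(* The comparison yields the point of [s] at parameter [t / T * D] instead of [t]; these parameters
   differ by [t / T * |T - D| <= d]. *)
suff : mdist (s t) (s (t / T * D)) <= d by lra.
case: sT => _ _ ->; rewrite ?in_itv/= -/D; last 2 first.
- by apply/andP; split; lra.
- rewrite mulr_ge0 ?divr_ge0 ?(ltW T0)//=; last lra.
  by rewrite ler_piMl ?ler_pdivrMr// ?mul1r; lra.
have -> : t - t / T * D = t / T * (T - D) by field; rewrite gt_eqF.
rewrite normrM ger0_norm ?divr_ge0 ?(ltW T0)//.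
apply: (@le_trans _ _ (1 * `|T - D|)).
  by rewrite ler_wpM2r// ler_pdivrMr// mul1r; lra.
by rewrite mul1r ler_norml; apply/andP; split; lra.
Qed.

(** At each time the geodesics from [x] to [c T] form a Cauchy family in [T]. Their unit speed
    passes to the limit, and so does their bound on the distance to [c], which does not depend on
    the time. *)
Lemma asymptotic_ray_exists c x : geodesic_ray X c ->
  exists c', [/\ geodesic_ray X c', c' 0 = x & asymptotic c' c].
Proof.
move=> cr; set d := mdist x (c 0).
have d0 : 0 <= d by exact: mdist_ge0.
have /choice[s sE] : forall T, exists s, geodesic x (c T) s.
  by move=> T; exact: (cat0P (R := R) (s := X)).1.
have cvg_s t : 0 <= t -> cvg (s T t @[T --> +oo]).
  move=> t0; apply: cauchy_cvg; apply: cauchy_exP => e e0.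
  (* The first two terms meet the size conditions of the chord estimate; the third makes its bound
     [16 * d * t ^ 2 / T] smaller than [e ^ 2]. *)
  pose T := 2 * t + 2 * d + 16 * d * t ^+ 2 / e ^+ 2 + 1.
  have q0 : 0 <= 16 * d * t ^+ 2 / e ^+ 2.
    by rewrite divr_ge0 ?mulr_ge0 ?exprn_ge0 ?(ltW e0).
  exists (s T t); rewrite ballEmdist.
  suff : \forall S \near +oo, mdist (s T t) (s S t) < e by [].
  near=> S.
  have TS : T <= S by near: S; apply: nbhs_pinfty_ge; rewrite num_real.
  rewrite -ltr_sqr ?nnegrE ?mdist_ge0 ?(ltW e0)//.
  apply: (le_lt_trans (geodesics_to_ray_dist cr (sE T) (sE S) _ _ TS t0 _));
    rewrite -/d /T; try lra.
  rewrite ltr_pdivrMr; last lra.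
  apply: (@le_lt_trans _ _ (e ^+ 2 * (16 * d * t ^+ 2 / e ^+ 2))).
    by rewrite [leRHS]mulrC divfK// expf_neq0// gt_eqF.
  by rewrite ltr_pM2l ?exprn_gt0//; lra.
pose c' t := lim (s T t @[T --> +oo]).
have near_c' t : 0 <= t -> forall e, 0 < e ->
    \forall T \near +oo, mdist (c' t) (s T t) < e.
  by move=> t0; exact: (metricType_numDomainType.cvgr_dist_lt (cvg_s t t0)).
exists c'; split.
- move=> t u t0 u0; apply/eqP; rewrite -subr_eq0 -normr_le0.
  apply/ler_addgt0Pl => e e0; rewrite addr0.
  near +oo_R => T.
  have tT : mdist (c' t) (s T t) < e / 2.
    by near: T; apply: near_c' => //; rewrite divr_gt0.
  have uT : mdist (c' u) (s T u) < e / 2.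
    by near: T; apply: near_c' => //; rewrite divr_gt0.
  (* As [mdist x (c T) >= T - d], both [t] and [u] then lie in the interval on which [s T] is a
     geodesic. *)
  have T_ge : t + u + d + 1 <= T.
    by near: T; apply: nbhs_pinfty_ge; rewrite num_real.
  have T0 : 0 <= T by lra.
  have := ray_dist_sub x cr T0; rewrite -/d ler_norml => /andP[D1 _].
  have [_ _ sTE] := sE T.
  have tuE : mdist (s T t) (s T u) = `|t - u|.
    by apply: sTE; rewrite in_itv/=; apply/andP; split; lra.
  have := mdist_nested (c' t) (c' u) (s T t) (s T u).
  have := mdist_nested (s T t) (s T u) (c' t) (c' u).
  rewrite tuE (metric_sym (s T t)) (metric_sym (s T u) (c' u)) => h1 h2.
  by rewrite ler_norml; apply/andP; split; lra.
- apply: cvg_lim; first exact: metric_hausdorff.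
  by apply: cvg_near_cst; apply: nearW => T; have [] := sE T.
- exists (1 + 2 * d) => t t0; near +oo_R => T.
  have tT : mdist (c' t) (s T t) < 1 by near: T; exact: near_c'.
  have T_ge : 2 * t + 2 * d + 1 <= T.
    by near: T; apply: nbhs_pinfty_ge; rewrite num_real.
  rewrite (le_trans (metric_triangle _ (s T t) _))// lerD ?(ltW tT)//.
  by apply: (geodesic_to_ray_dist cr (sE T)); rewrite -/d; lra.
Unshelve. all: by end_near. Qed.

End asymptotic_ray.

(** * Monotonicity and limit of comparison angles *)

Section comparison_angle.
Context {R : realType}.

Lemma cos_comparison_angle (X : metricType R) (x y z : X) :
    0 < mdist x y -> 0 < mdist x z ->
  0 <= comparison_angle x y z <= pi /\
  2 * mdist x y * mdist x z * cos (comparison_angle x y z) =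
  mdist x y ^+ 2 + mdist x z ^+ 2 - mdist y z ^+ 2.
Proof.
rewrite /comparison_angle => xy xz.
set q := (_ / _).
have xyz0 : 0 < 2 * mdist x y * mdist x z by rewrite !mulr_gt0.
have q1 : -1 <= q <= 1.
  have yz := mdist_ge0 y z.
  have xyz := metric_triangle x z y.
  have xzy := metric_triangle x y z.
  have yxz := metric_triangle y x z.
  rewrite (metric_sym z y) in xyz; rewrite (metric_sym y x) in yxz.
  by apply/andP; split; rewrite /q ?ler_pdivlMr ?ler_pdivrMr//; nra.
have [q0pi ->] := acos_def q1; split => //.
by rewrite /q mulrCA divff ?mulr1// gt_eqF.
Qed.

Lemma ray_comparison_angle (X : metricType R) (c c' : R -> X) (t s : R) :
    geodesic_ray X c -> geodesic_ray X c' -> c 0 = c' 0 -> 0 < t -> 0 < s ->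
  0 <= comparison_angle (c 0) (c t) (c' s) <= pi /\
  2 * t * s * cos (comparison_angle (c 0) (c t) (c' s)) =
  t ^+ 2 + s ^+ 2 - mdist (c t) (c' s) ^+ 2.
Proof.
move=> cr c'r c0 t0 s0.
have ct := ray_dist0 cr (ltW t0).
have c's : mdist (c 0) (c' s) = s by rewrite c0 ray_dist0// ltW.
by have := @cos_comparison_angle _ (c 0) (c t) (c' s); rewrite ct c's; exact.
Qed.

(** Since cosine decreases on [[0, pi]], cosines are compared. The points [c t] and [c' s] divide
    two sides of the larger triangle in the ratios [t / t'] and [s / s'], so the CAT(0) inequality
    bounds their distance by the law of cosines with the larger triangle's angle. *)
Lemma le_comparison_angle (X : hadamardType R) (c c' : R -> X) (t t' s s' : R) :
    geodesic_ray X c -> geodesic_ray X c' -> c 0 = c' 0 ->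
    0 < t -> t <= t' -> 0 < s -> s <= s' ->
  comparison_angle (c 0) (c t) (c' s) <= comparison_angle (c 0) (c t') (c' s').
Proof.
move=> cr c'r c0 t0 tt' s0 ss'.
have t'0 : 0 < t' := lt_le_trans t0 tt'.
have s'0 : 0 < s' := lt_le_trans s0 ss'.
have [A0pi AE] := ray_comparison_angle cr c'r c0 t0 s0.
have [A'0pi A'E] := ray_comparison_angle cr c'r c0 t'0 s'0.
rewrite leNgt -ltr_cos ?in_itv// -leNgt.
rewrite -(@ler_pM2l _ (2 * t * s)) ?mulr_gt0// AE.
have gc := ray_geodesic cr (ltW t'0).
have gc' := ray_geodesic c'r (ltW s'0); rewrite -c0 in gc'.
have a01 : 0 <= t / t' <= 1.
  by rewrite divr_ge0 ?(ltW t0) ?(ltW t'0)//= ler_pdivrMr// mul1r.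
have b01 : 0 <= s / s' <= 1.
  by rewrite divr_ge0 ?(ltW s0) ?(ltW s'0)//= ler_pdivrMr// mul1r.
have := cat0_sides_dist gc gc' a01 b01.
rewrite (ray_dist0 cr (ltW t'0)) c0 (ray_dist0 c'r (ltW s'0)) -c0 -A'E.
rewrite !divfK ?gt_eqF//.
have -> : (t / t') ^+ 2 * t' ^+ 2 = t ^+ 2 by field; rewrite gt_eqF.
have -> : (s / s') ^+ 2 * s' ^+ 2 = s ^+ 2 by field; rewrite gt_eqF.
set k := cos _.
have -> : t / t' * (s / s') * (2 * t' * s' * k) = 2 * t * s * k.
  by field; rewrite !gt_eqF.
by lra.
Qed.

Lemma comparison_angle_cvg (X : hadamardType R) (c c' : R -> X) :
    geodesic_ray X c -> geodesic_ray X c' -> c 0 = c' 0 ->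
  exists theta : R, (fun t : R * R => comparison_angle (c 0) (c t.1) (c' t.2)) @
      (pinfty_nbhs R, pinfty_nbhs R) --> theta.
Proof.
move=> cr c'r c0.
(* By monotonicity the limit is this supremum. Parameter 0 is excluded: there the quotient under
   [acos] has denominator 0 and the angle is meaningless. *)
pose S := [set comparison_angle (c 0) (c t.1) (c' t.2) |
  t in [set t : R * R | 0 < t.1 /\ 0 < t.2]].
have supS : has_sup S.
  split; first by exists (comparison_angle (c 0) (c 1) (c' 1)), (1, 1) => /=.
  exists pi => _ [[t s] /= [t0 s0] <-].
  by have [/andP[]] := ray_comparison_angle cr c'r c0 t0 s0.
exists (sup S); apply/cvgrPdist_le => e e0.
have [_ [[t0 s0] /= [t00 s00] <-] lt_sup] := sup_adherent e0 supS.
exists ([set t | t0 <= t], [set s | s0 <= s]) => /=.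
  by split; apply: nbhs_pinfty_ge; rewrite num_real.
move=> [t s] /= [t0t s0s].
have le_sup : comparison_angle (c 0) (c t) (c' s) <= sup S.
  apply: sup_upper_bound => //; exists (t, s) => //=.
  by split; [exact: lt_le_trans t0t|exact: lt_le_trans s0s].
have := le_comparison_angle cr c'r c0 t00 t0t s00 s0s.
by rewrite ger0_norm ?subr_ge0//; lra.
Qed.

Lemma comparison_angle_le_lim (X : hadamardType R) (c c' : R -> X)
    (theta t s : R) :
    geodesic_ray X c -> geodesic_ray X c' -> c 0 = c' 0 ->
    (fun t : R * R => comparison_angle (c 0) (c t.1) (c' t.2)) @
      (pinfty_nbhs R, pinfty_nbhs R) --> theta ->
    0 < t -> 0 < s ->
  comparison_angle (c 0) (c t) (c' s) <= theta.
Proof.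
move=> cr c'r c0 cvg_theta t0 s0; apply: (cvgr_to_ge cvg_theta).
exists ([set t' | t <= t'], [set s' | s <= s']) => /=.
  by split; apply: nbhs_pinfty_ge; rewrite num_real.
by move=> [t' s'] /= [tt' ss']; exact: le_comparison_angle.
Qed.

Lemma lim_comparison_angle_le_pi (X : hadamardType R) (c c' : R -> X)
    (theta : R) :
    geodesic_ray X c -> geodesic_ray X c' -> c 0 = c' 0 ->
    (fun t : R * R => comparison_angle (c 0) (c t.1) (c' t.2)) @
      (pinfty_nbhs R, pinfty_nbhs R) --> theta ->
  theta <= pi.
Proof.
move=> cr c'r c0 cvg_theta; apply: (cvgr_to_le cvg_theta).
exists ([set t | 0 < t], [set s | 0 < s]) => /=.
  by split; apply: nbhs_pinfty_gt; rewrite num_real.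
move=> [t s] /= [t0 s0].
by have [/andP[]] := ray_comparison_angle cr c'r c0 t0 s0.
Qed.

Lemma ray_dist_sqr_le_angle (X : hadamardType R) (c c' : R -> X)
    (theta t s : R) :
    geodesic_ray X c -> geodesic_ray X c' -> c 0 = c' 0 ->
    (fun t : R * R => comparison_angle (c 0) (c t.1) (c' t.2)) @
      (pinfty_nbhs R, pinfty_nbhs R) --> theta ->
    0 < t -> 0 < s ->
  mdist (c t) (c' s) ^+ 2 <= t ^+ 2 + s ^+ 2 - 2 * t * s * cos theta.
Proof.
move=> cr c'r c0 cvg_theta t0 s0.
have [A0pi AE] := ray_comparison_angle cr c'r c0 t0 s0.
have A_le := comparison_angle_le_lim cr c'r c0 cvg_theta t0 s0.
have theta_pi := lim_comparison_angle_le_pi cr c'r c0 cvg_theta.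
have le_cos : cos theta <= cos (comparison_angle (c 0) (c t) (c' s)).
  rewrite leNgt ltr_cos ?in_itv/= ?theta_pi ?andbT -?leNgt//.
  by case/andP: A0pi => /le_trans + _; apply.
have ts0 : 0 <= 2 * t * s by rewrite !mulr_ge0// ltW.
by have := ler_wpM2l ts0 le_cos; rewrite AE; lra.
Qed.

End comparison_angle.

(** * Busemann functions and their bound by the angle *)

Section busemann.
Context {R : realType} {X : metricType R}.

Lemma busemann_is_cvg (c : R -> X) (x : X) : geodesic_ray X c ->
  cvg (mdist x (c t) - t @[t --> +oo]).
Proof.
move=> cr.
(* The triangle inequality makes [t - mdist x (c t)] nondecreasing for [t >= 0]; truncation at 0
   makes it so on the whole line, where the values of [c] at negative times are arbitrary. *)
pose u t := Num.max t 0 - mdist x (c (Num.max t 0)).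
have le_u : {homo u : s t / s <= t}.
  move=> s t st; rewrite /u.
  set s' := Num.max s 0; set t' := Num.max t 0.
  have s'0 : 0 <= s' by rewrite /s' le_max lexx orbT.
  have st' : s' <= t'.
    by rewrite /s' ge_max !le_max st lexx !orbT.
  have := metric_triangle x (c s') (c t').
  by rewrite cr//; [rewrite distrC ger0_norm ?subr_ge0//; lra|exact: le_trans st'].
have ub_u : has_ubound (range u).
  exists (mdist x (c 0)) => _ [t _ <-]; rewrite /u.
  have t0 : 0 <= Num.max t 0 by rewrite le_max lexx orbT.
  by have := ray_dist_sub x cr t0; rewrite ler_norml => /andP[+ _]; lra.
have cvg_u := cvgN (nondecreasing_cvgr le_u ub_u).
have uE : {near +oo_R, (fun t => - u t) =1 (fun t => mdist x (c t) - t)}.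
  near=> t; have t0 : 0 <= t by near: t; apply: nbhs_pinfty_ge; rewrite num_real.
  by rewrite /u max_l// opprB.
apply/cvg_ex; exists (- sup (range u)) => A /cvg_u; exact: near_eq_cvg uE _.
Unshelve. all: by end_near. Qed.

Lemma busemann_le (c : R -> X) (x : X) (t : R) : geodesic_ray X c -> 0 <= t ->
  busemann c x <= mdist x (c t) - t.
Proof.
move=> cr t0; apply: limr_le; first exact: busemann_is_cvg.
near=> s.
have ts : t <= s by near: s; apply: nbhs_pinfty_ge; rewrite num_real.
have cts : mdist (c t) (c s) = s - t.
  by rewrite cr ?(le_trans t0 ts)// distrC ger0_norm ?subr_ge0.
by have := metric_triangle x (c t) (c s); rewrite cts; lra.
Unshelve. all: by end_near. Qed.

End busemann.

(** The law of cosines bounds [mdist (c t) (c' s)] by [s - t * cos theta + e] for [s] large. Passing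
    from [c], [c'] to [d], [d'] costs [K + K']. *)
Lemma busemann_le_angle (R : realType) (X : hadamardType R)
    (c c' d d' : R -> X) (theta K K' t : R) :
    geodesic_ray X c -> geodesic_ray X c' -> c 0 = c' 0 ->
    (fun t : R * R => comparison_angle (c 0) (c t.1) (c' t.2)) @
      (pinfty_nbhs R, pinfty_nbhs R) --> theta ->
    geodesic_ray X d' ->
    (forall s, 0 <= s -> mdist (d s) (c s) <= K) ->
    (forall s, 0 <= s -> mdist (d' s) (c' s) <= K') ->
    0 < t ->
  busemann d' (d t) <= - (t * cos theta) + K + K'.
Proof.
move=> cr c'r c0 cvg_theta d'r dK d'K t0.
apply/ler_addgt0Pr => e e0.
(* With this [s], the term [2 * e * s] in the square of [s - t * cos theta + e] supplies the [t ^ 2]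
   of the law of cosines, and what is left over is nonnegative. *)
pose s := t + t ^+ 2 / (2 * e).
have sE : 2 * e * s = 2 * e * t + t ^+ 2 by rewrite /s; field; rewrite gt_eqF.
have ts : t <= s.
  by rewrite /s lerDl divr_ge0 ?exprn_ge0// ?mulr_ge0// ltW.
have s0 : 0 < s := lt_le_trans t0 ts.
have kt : t * cos theta <= t by rewrite ler_piMr ?cos_le1// ltW.
have cc' : mdist (c t) (c' s) <= s - t * cos theta + e.
  rewrite -(@ler_pXn2r _ 2) ?nnegrE ?mdist_ge0//; last lra.
  apply: (le_trans (ray_dist_sqr_le_angle cr c'r c0 cvg_theta t0 s0)).
  have : 0 <= e * (t - t * cos theta) by rewrite mulr_ge0 ?(ltW e0)// subr_ge0.
  have : 0 <= (t * cos theta) ^+ 2 by exact: sqr_ge0.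
  have : 0 <= e ^+ 2 by exact: sqr_ge0.
  by nra.
have := busemann_le (d t) d'r (ltW s0).
have := mdist_nested (d t) (d' s) (c t) (c' s).
have := dK _ (ltW t0); have := d'K _ (ltW s0).
by lra.
Qed.

(** * Slopes of convex functions along rays *)

Section recession.
Context {R : realType} {X : metricType R}.

Lemma convex_ray_slope (f : X -> R) (c : R -> X) (s t : R) :
    geodesically_convex f -> geodesic_ray X c -> 0 < s -> s <= t ->
  (f (c s) - f (c 0)) / s <= (f (c t) - f (c 0)) / t.
Proof.
move=> fconv cr s0 st; have t0 : 0 < t := lt_le_trans s0 st.
have a0 : 0 <= s / t by rewrite divr_ge0 ?ltW.
have a1 : s / t <= 1 by rewrite ler_pdivrMr// mul1r.
have fst : f (c (s / t * t + (1 - s / t) * 0)) <=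
    s / t * f (c t) + (1 - s / t) * f (c 0).
  have := fconv _ _ _ (ray_geodesic cr (ltW t0)) (Itv01 a0 a1) t 0.
  by rewrite !inE/= !in_itv/= (ray_dist0 cr (ltW t0)) !lexx (ltW t0); exact.
rewrite mulr0 addr0 divfK ?gt_eqF// in fst.
rewrite ler_pdivrMr// mulrAC -mulrA; lra.
Qed.

Lemma cvg_divr_pinfty (a : R) : a / t @[t --> +oo] --> 0.
Proof.
rewrite -(mulr0 a); apply: cvgM; first exact: cvg_cst.
apply/gtr0_cvgV0; last exact: cvg_id.
by apply: nbhs_pinfty_gt; rewrite num_real.
Qed.

Lemma convex_ray_cvg (f : X -> R) (c : R -> X) :
    geodesically_convex f -> geodesic_ray X c ->
  exists l : \bar R, (f (c t) / t)%:E @[t --> +oo] --> l.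
Proof.
move=> fconv cr.
(* Slopes from [c 0] are monotone, so they converge in the extended reals, and [f (c 0) / t]
   vanishes in the limit. Truncation at 1 keeps the denominator positive. *)
pose g t := ((f (c (Num.max t 1)) - f (c 0)) / Num.max t 1)%:E.
have le_g : {homo g : s t / s <= t >-> (s <= t)%E}.
  move=> s t st; rewrite /g lee_fin; apply: (convex_ray_slope fconv cr).
    by rewrite lt_max ltr01 orbT.
  by rewrite ge_max !le_max st lexx !orbT.
exists (ereal_sup (range g) + 0%:E)%E.
have cvg_g : (g t + (f (c 0) / t)%:E)%E @[t --> +oo] -->
    (ereal_sup (range g) + 0%:E)%E.
  apply: cvgeD; [exact: fin_num_adde_defl|exact: (nondecreasing_cvge le_g)|].
  by apply: cvg_EFin; [exact: nearW|exact: (cvg_divr_pinfty (f (c 0)))].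
have gE : {near +oo_R, (fun t => g t + (f (c 0) / t)%:E)%E =1
    (fun t => (f (c t) / t)%:E)}.
  near=> t; have t1 : 1 <= t by near: t; apply: nbhs_pinfty_ge; rewrite num_real.
  by rewrite /g max_l// -EFinD -mulrDl subrK.
by move=> A /cvg_g; exact: near_eq_cvg gE _.
Unshelve. all: by end_near. Qed.

End recession.

(** * Angle, Busemann and recession functions on boundary and cone *)

Section boundary_rays.
Context {R : realType} {X : hadamardType R}.
Implicit Types (xi : boundary X) (p : cone X) (x : X).

Lemma endpoint_eq (c c' : geodesic_ray X) :
  endpoint c = endpoint c' <-> asymptotic (val c) (val c').
Proof.
split=> [/eqmodP/asboolP //|cc'].
by apply/eqmodP/asboolP.
Qed.

Lemma ray_from_exists x xi : exists c, ray_from x xi c.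
Proof.
have [c' [c'r c'0 c'_asym]] := asymptotic_ray_exists x (set_valP (repr xi)).
exists (SigSub (mem_set c'r)); split => //.
by rewrite -[RHS]reprK; apply/endpoint_eq.
Qed.

(** [angle] is a choice from a set of limits; once that set is known to be nonempty, the chosen
    value is attained by some pair of rays, over whose base point there is no control. *)
Lemma angle_cvg xi xi' : exists x c c',
  [/\ ray_from x xi c, ray_from x xi' c' &
    (fun t : R * R => comparison_angle x (val c t.1) (val c' t.2)) @
      (pinfty_nbhs R, pinfty_nbhs R) --> angle xi xi'].
Proof.
apply: (@getPex R [set theta : R | exists x c c',
  [/\ ray_from x xi c, ray_from x xi' c' &
    (fun t : R * R => comparison_angle x (val c t.1) (val c' t.2)) @
      (pinfty_nbhs R, pinfty_nbhs R) --> theta]]).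
pose x : X := point.
have [c cx] := ray_from_exists x xi.
have [c' c'x] := ray_from_exists x xi'.
have c0 : val c 0 = val c' 0 by rewrite cx.1 c'x.1.
have [theta cvg_theta] := comparison_angle_cvg (set_valP c) (set_valP c') c0.
by exists theta, x, c, c'; split => //; rewrite -cx.1.
Qed.

Lemma based_rayP x xi : [set val c | c in ray_from x xi] (based_ray x xi).
Proof.
apply: xgetPex; have [c cx] := ray_from_exists x xi.
by exists (val c), c.
Qed.

Lemma cone_pt_eq (r r' : {nonneg R}) xi xi' :
  cone_pt r xi = cone_pt r' xi' -> r = r' /\ (r%:num = 0 \/ xi = xi').
Proof.
by move=> /eqmodP /andP[/= /eqP rr' /orP[/eqP|/eqP]]; split; auto.
Qed.

(** The cone identifies different directions only at radius 0, so at radius 1 the chosen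
    representative is forced. *)
Lemma cone_of_boundary_repr xi :
  cone_norm (cone_of_boundary xi) = 1 /\ cone_dir (cone_of_boundary xi) = xi.
Proof.
rewrite /cone_norm /cone_dir.
have : cone_pt (repr (cone_of_boundary xi)).1 (repr (cone_of_boundary xi)).2 =
  cone_pt 1%:nng xi by rewrite /cone_pt -surjective_pairing reprK.
case/cone_pt_eq => -> [|//] /= /eqP; by rewrite oner_eq0.
Qed.

Lemma constant_speed_ray_to_boundary xi (c : R -> X) :
  constant_speed_ray_to (cone_of_boundary xi) c ->
  exists2 c' : geodesic_ray X, c = val c' & endpoint c' = xi.
Proof.
move=> [r [c' [-> /cone_pt_eq[-> [/eqP|c'xi]]]]]; first by rewrite oner_eq0.
by exists c' => //; apply/funext => t; rewrite /= mul1r.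
Qed.

(** Convexity makes the set of limits in [recession] nonempty, so its value is a limit along some
    unit-speed ray of the class. *)
Lemma recession_cvg (f : X -> R) xi : geodesically_convex f ->
  exists2 c : geodesic_ray X, endpoint c = xi &
    (f (val c t) / t)%:E @[t --> +oo] --> recession f (cone_of_boundary xi).
Proof.
move=> fconv; pose P := [set l : \bar R |
  exists2 c, constant_speed_ray_to (cone_of_boundary xi) c &
    (f (c t) / t)%:E @[t --> +oo] --> l].
have /getPex[c /constant_speed_ray_to_boundary[c' -> c'xi] cvg_f] :
    exists l, P l.
  have [c cx] := ray_from_exists point xi.
  have [l cvg_l] := convex_ray_cvg fconv (set_valP c).
  exists l, (val c) => //; exists 1%:nng, c; rewrite cx.2; split => //.
  by apply/funext => t; rewrite /= mul1r.
by exists c'.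
Qed.

(* The base points of the rays that define the angle, the recession function
   and the Busemann function need not agree: asymptotic rays are at bounded
   distance, which only costs a constant. *)
Lemma cone_busemann_le x0 xi p (c : geodesic_ray X) : endpoint c = xi ->
  exists K, forall t, 0 < t -> cone_busemann x0 p (val c t) <=
    K - t * cone_inner (cone_of_boundary xi) p.
Proof.
move=> cxi; rewrite /cone_busemann /cone_inner.
have [-> ->] := cone_of_boundary_repr xi; rewrite mul1r.
set r := cone_norm p; set xi' := cone_dir p.
have [x [d [d' [dx d'x cvg_angle]]]] := angle_cvg xi xi'.
have d0 : val d 0 = val d' 0 by rewrite dx.1 d'x.1.
rewrite -dx.1 in cvg_angle.
have [c' c'x0 <-] := based_rayP x0 xi'.
have [K cK] : asymptotic (val c) (val d).
  by apply/endpoint_eq; rewrite cxi dx.2.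
have [K' c'K'] : asymptotic (val c') (val d').
  by apply/endpoint_eq; rewrite c'x0.2 d'x.2.
exists (r * (K + K')) => t t0.
have r0 : 0 <= r by rewrite /r /cone_norm.
have := busemann_le_angle (set_valP d) (set_valP d') d0 cvg_angle (set_valP c')
  cK c'K' t0.
by move=> /(ler_wpM2l r0); lra.
Qed.

End boundary_rays.

Theorem lemma2p14 (R : realType) (X : hadamardType R) (x0 : X) (f : X -> R)
    (f_continuous : continuous f) (f_convex : geodesically_convex f) :
  dom_conjugate x0 f `<=` B (recession f).
Proof.
move=> p; rewrite /dom_conjugate/= => f_lty xi.
have [C fC] : exists C, forall x, - cone_busemann x0 p x - f x <= C.
  have f_ge x : ((- cone_busemann x0 p x - f x)%:E <= conjugate x0 f p)%E.
    by apply: ereal_sup_ubound; exists x.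
  (* The value [-oo] is excluded by the real number that [x0] contributes to the supremum. *)
  move: f_lty f_ge; case: (conjugate x0 f p) => [C _ f_ge| // |_ f_ge].
    by exists C => x; rewrite -lee_fin.
  by have := f_ge x0.
have [c cxi cvg_f] := recession_cvg xi f_convex.
have [K cK] := cone_busemann_le x0 p cxi.
set k := cone_inner _ _ in cK *.
(* The two bounds combine to [f (c t) >= t * k - (C + K)]; divided by [t], the right-hand side tends
   to [k]. *)
have cvg_k : (k - (C + K) / t)%:E @[t --> +oo] --> k%:E.
  apply: cvg_EFin; first exact: nearW.
  rewrite -[X in _ --> X]subr0; apply: cvgB; first exact: cvg_cst.
  exact: cvg_divr_pinfty.
apply: (lee_cvg_to cvg_k cvg_f); near=> t.
have t0 : 0 < t by near: t; apply: nbhs_pinfty_gt; rewrite num_real.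
rewrite lee_fin ler_pdivlMr// mulrBl divfK ?gt_eqF//.
by have := fC (val c t); have := cK t t0; lra.
Unshelve. all: by end_near. Qed.
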